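(* Let $L$ be a Latin square of order $n$ with $n \equiv 2 \pmod 4$. Then the number $E_n(L)$ of transversals of $L$ satisfies $E_n(L) \equiv 0 \pmod 4$.
   Context: A Latin square of order $n$ is an $n\times n$ matrix with symbols from $[n]=\{1,\dots,n\}$ in which each symbol appears exactly once in each row and exactly once in each column. A diagonal is a selection of $n$ entries (cells), exactly one from each row and exactly one from each column. A transversal is a diagonal on which $n$ distinct symbols appear. $E_n(L)$ denotes the number of transversals of $L$. *)

(* Defs.v *)
From mathcomp Require Import all_boot all_algebra.
Set Implicit Arguments.
Unset Strict Implicit.
Unset Printing Implicit Defensive.

(* Rows, columns and symbols are all indexed by 'I_n = {0, ..., n-1}, standing
   for {1, ..., n}. *)
Definition latin_square n (L : 'M['I_n]_n) : bool :=
  [forall i : 'I_n, forall s : 'I_n, #|[set j : 'I_n | L i j == s]| == 1] &&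
  [forall j : 'I_n, forall s : 'I_n, #|[set i : 'I_n | L i j == s]| == 1].

(* A cell is a pair (row, column). *)
Definition diagonal n (D : {set 'I_n * 'I_n}) : bool :=
  [&& #|D| == n,
      [forall i : 'I_n, #|[set c in D | c.1 == i]| == 1] &
      [forall j : 'I_n, #|[set c in D | c.2 == j]| == 1]].

Definition latin_transversal n (L : 'M['I_n]_n) (D : {set 'I_n * 'I_n}) : bool :=
  diagonal D && (#|[set L c.1 c.2 | c in D]| == n).

Definition num_transversals n (L : 'M['I_n]_n) : nat :=
  #|[set D : {set 'I_n * 'I_n} | latin_transversal L D]|.

(* Main.v *)
Require Import Defs.
From mathcomp Require Import all_boot all_algebra.
From mathcomp Require Import all_fingroup zify ring.
Set Implicit Arguments.
Unset Strict Implicit.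
Unset Printing Implicit Defensive.
Import GRing.Theory.

(** Write a transversal of a Latin square [L] as a pair of permutations
    [(s, t)] with [L i (s i) = t i]: row [i] is used in column [s i] with
    symbol [t i].  Its signs [e1] (of [s]), [e2] (of [t]) and [e1 * e2] (of
    the column-to-symbol permutation [s^-1 * t]) satisfy
    [1 + e1 + e2 + e1 * e2 = (1 + e1) * (1 + e2)], which is 0 or 4.  So,
    modulo 4, the number of transversals is minus the sum of three signed
    counts: transversals weighted by [e1], by [e2] and by [e1 * e2].  The last
    two are the first one taken in conjugates of [L] (the roles of rows,
    columns and symbols being permuted), which are Latin squares of the same
    order.  It is enough that 4 divides the signed count of every Latin square
    of order [n = 2 m] with [m] odd ([dvdz4_signed_count]).

    Unlike the plain count, the signed count is a sum of determinants.  For a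
    set [S] of symbols let [A_S] be the 0/1 matrix of the cells with symbol in
    [S]; inclusion-exclusion over symbols gives
    [signed_count L = \sum_S (-1)^(n - #|S|) \det A_S]
    ([signed_count_det]).  All row and column sums of [A_S] are
    [#|S|], so [\det A_S = #|S| * c_S] where [c_S] is the determinant of [A_S]
    with its first row replaced by ones.  As [A_(~: S)] is the all-ones matrix
    minus [A_S] and [n] is even, [c_(~: S) = - c_S].  Hence [S] and [~: S]
    together contribute [c_S * (2 * #|S| - n) = 2 * c_S * (#|S| - m)] up to
    sign.  If [#|S|] is odd, then [#|S| - m] is even.  If [#|S|] is even,
    then so is [c_S], because every row of its matrix sums to [n] or to
    [#|S|].  Either way 4 divides the contribution. *)

Local Open Scope ring_scope.

(** * Determinants with a row of ones *)

Lemma lift0_eq0F n (i : 'I_n) : (lift ord0 i == ord0) = false.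
Proof. by []. Qed.

Section UnitRow.
Variables (R : comNzRingType) (n : nat) (A : 'M[R]_n.+1).

Definition unit_row (B : 'M[R]_n.+1) : 'M[R]_n.+1 :=
  \matrix_(i, j) if i == ord0 then 1 else B i j.

(** The all-ones row vector [u] satisfies [u *m A = k *: u]; compare
    [u *m A *m \adj A] with [\det A *: u] in the first entry, which on the left
    is [k] times the expansion of [\det (unit_row A)] along its row of ones. *)
Lemma det_const_col_sum k :
  (forall j, \sum_i A i j = k) -> \det A = k * \det (unit_row A).
Proof.
move=> colA; rewrite (expand_det_row (unit_row A) ord0).
have cof j : cofactor (unit_row A) ord0 j = cofactor A ord0 j.
  congr (_ * \det _); apply/matrixP=> x y; rewrite !mxE.
  by rewrite lift0_eq0F.
under eq_bigr => j _ do rewrite cof mxE eqxx mul1r.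
have /matrixP/(_ ord0 ord0) :
    const_mx 1 *m A *m \adj A = (const_mx 1 : 'rV_n.+1) *m (\det A)%:M.
  by rewrite -mulmxA mul_mx_adj.
rewrite mul_mx_scalar !mxE mulr1 => <-; rewrite mulr_sumr.
apply: eq_bigr => j _; rewrite !mxE -(colA j).
by congr (_ * _); apply: eq_bigr => i _; rewrite mxE mul1r.
Qed.

(** Subtracting each of the [n] other rows from the row of ones, instead of the
    converse, turns [A] into its complement and flips [n] signs. *)
Lemma det_unit_row_compl :
  \det (unit_row (const_mx 1 - A)) = (-1) ^+ n * \det (unit_row A).
Proof.
(* The row operation itself: row 0 is kept, row i becomes row 0 - row i. *)
pose U : 'M[R]_n.+1 :=
  \matrix_(i, j) if i == ord0 then (j == ord0)%:R
                 else (j == ord0)%:R - (i == j)%:R.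
have -> : unit_row (const_mx 1 - A) = U *m unit_row A.
  apply/matrixP=> i j; rewrite !mxE big_ord_recl !mxE eqxx.
  case: (unliftP ord0 i) => [i' ->|->]; last first.
    rewrite eqxx mulr1 big1 ?addr0 // => l _.
    by rewrite !mxE eqxx lift0_eq0F mul0r.
  rewrite !lift0_eq0F subr0 mulr1; congr (_ + _).
  rewrite (bigD1 i') //= big1 => [|l li].
    by rewrite !mxE !lift0_eq0F eqxx addr0 sub0r mulN1r.
  by rewrite !mxE !lift0_eq0F (inj_eq lift_inj) eq_sym (negbTE li) subr0 mul0r.
rewrite det_mulmx; congr (_ * _); rewrite det_trig; last first.
  apply/is_trig_mxP=> i j lt_ij; rewrite !mxE.
  have /negbTE-> : j != ord0 by apply: contraTneq lt_ij => ->.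
  by rewrite (ltn_eqF lt_ij : (i == j) = false) subr0; case: ifP.
rewrite big_ord_recl mxE eqxx mul1r (eq_bigr (fun _ => -1 : R)).
  by rewrite prodr_const card_ord.
by move=> i _; rewrite mxE lift0_eq0F eqxx sub0r.
Qed.

End UnitRow.

(** [A] sends the all-ones vector to a multiple of [d], hence so does
    [\adj A *m A], which is multiplication by [\det A]. *)
Lemma dvdz_det_row_sum n (A : 'M[int]_n) (d : int) (i0 : 'I_n) :
  (forall i, (d %| \sum_j A i j)%Z) -> (d %| \det A)%Z.
Proof.
move=> rowA.
have /matrixP/(_ i0 ord0) :
    \adj A *m (A *m const_mx 1) = (\det A)%:M *m (const_mx 1 : 'cV_n).
  by rewrite mulmxA mul_adj_mx.
rewrite mul_scalar_mx !mxE mulr1 => <-; apply: rpred_sum => i _.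
rewrite dvdz_mull // !mxE.
by under eq_bigr => j _ do rewrite mxE mulr1.
Qed.

(** * Transversals and their signed count *)

Definition latin n (L : 'I_n -> 'I_n -> 'I_n) : Prop :=
  (forall i, injective (L i)) /\ (forall j, injective (L^~ j)).

Definition transversal_pair n (L : 'I_n -> 'I_n -> 'I_n) (p : 'S_n * 'S_n) :=
  [forall i, L i (p.1 i) == p.2 i].

(** The sign is that of the row-to-column permutation. *)
Definition signed_count n (L : 'I_n -> 'I_n -> 'I_n) : int :=
  \sum_(p | transversal_pair L p) (-1) ^+ p.1.

Definition symbol_mx n (L : 'I_n -> 'I_n -> 'I_n) (S : {set 'I_n}) : 'M[int]_n :=
  \matrix_(i, j) (L i j \in S)%:R.

Lemma sum_mem_inj n (f : 'I_n -> 'I_n) (S : {set 'I_n}) :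
  injective f -> \sum_i (f i \in S)%:R = #|S|%:R :> int.
Proof.
move=> injf; rewrite -sum1_card natr_sum [RHS]big_mkcond /=.
rewrite [RHS](reindex_inj injf) /=; apply: eq_bigr => i _.
by case: (f i \in S).
Qed.

(** Ryser's formula for the permanent of the 0/1 matrix of the graph of [f],
    whose only possible nonzero term is [f] itself: the alternating sum over
    [S] containing the image of [f] vanishes unless that image is everything. *)
Lemma ryser_function n (f : 'I_n -> 'I_n) :
  \sum_(S : {set 'I_n}) (-1) ^+ #|~: S| * \prod_i (f i \in S)%:R
  = #|[pred t : 'S_n | [forall i, f i == t i]]|%:R :> int.
Proof.
have prodE (S : {set 'I_n}) : \prod_i (f i \in S)%:R = (f @: setT \subset S)%:R :> int.
  have [sub|] := boolP (_ \subset S).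
    by rewrite big1 // => i _; rewrite (subsetP sub) ?imset_f.
  case/subsetPn=> _ /imsetP[i _ ->] fiS.
  by rewrite (bigD1 i) //= (negbTE fiS) mul0r.
(* Expanding this product over s, each s outside S picks - (s \notin f @: setT). *)
transitivity (\prod_s (1 - (s \notin f @: setT)%:R) : int).
  rewrite bigA_distr; apply: eq_bigr => S _; rewrite prodE.
  rewrite (bigID (mem S)) /= big1 => [|s sS]; last by rewrite sS.
  rewrite mul1r.
  have [sub|] := boolP (_ \subset S).
    rewrite (eq_bigr (fun _ => -1 : int)).
      by rewrite prodr_const mulr1; congr (_ ^+ _); apply: eq_card => s;
        rewrite !inE.
    move=> s sS; rewrite (negbTE sS).
    by rewrite (contra (subsetP sub s) sS).
  case/subsetPn=> s sf sS.
  by rewrite (bigD1 s) //= (negbTE sS) sf oppr0 mul0r mulr0.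
have [/injectiveP injf|ninjf] := boolP (injectiveb f).
  rewrite big1 => [|s _]; last first.
    by rewrite -[s](f_invF injf) imset_f ?subr0.
  rewrite (eq_card (B := pred1 (perm injf))) ?card1 // => t; rewrite !inE.
  apply/forallP/eqP => [h|-> i]; last by rewrite permE.
  by apply/permP=> i; rewrite permE; apply/esym/eqP/h.
rewrite eq_card0 => [|t]; last first.
  rewrite !inE; apply/negbTE/negP=> /forallP h; case/negP: ninjf.
  apply/injectiveP=> i j; rewrite (eqP (h i)) (eqP (h j)); exact: perm_inj.
have [s sf] : exists s, s \notin f @: setT.
  apply/existsP; apply: contraR ninjf; rewrite negb_exists => /forallP h.
  apply/injectiveP.
  have /imset_injP h' : #|f @: setT| == #|[set: 'I_n]|.
    by apply/eqP/eq_card=> s; move: (h s); rewrite negbK inE.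
  by move=> i j; apply: h'; rewrite inE.
by rewrite (bigD1 s) //= sf subrr mul0r.
Qed.

(** Leibniz's formula makes [\det (symbol_mx L S)] the signed count of the
    diagonals all of whose symbols lie in [S]; Ryser's formula then keeps the
    diagonals on which every symbol occurs. *)
Lemma signed_count_det n (L : 'I_n -> 'I_n -> 'I_n) :
  signed_count L = \sum_(S : {set 'I_n}) (-1) ^+ #|~: S| * \det (symbol_mx L S).
Proof.
under [RHS]eq_bigr => S _ do rewrite mulr_sumr.
rewrite exchange_big /signed_count -(pair_big_dep xpredT
  (fun s t : 'S_n => [forall i, L i (s i) == t i])
  (fun s t => (-1) ^+ odd_perm s)) /=.
apply: eq_bigr => s _; rewrite sumr_const.
rewrite -[LHS]mulr_natr -ryser_function mulr_sumr.
apply: eq_bigr => S _; rewrite mulrCA; congr (_ * (_ * _)).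
by apply: eq_bigr => i _; rewrite mxE.
Qed.

(** In the sum of determinants, the terms of [S] and of its complement add up to
    [c S * (#|S| - #|~: S|)] up to sign; both factors are even if [#|S|] is
    even, and the second is a multiple of 4 if [#|S|] is odd. *)
Lemma dvdz4_signed_count n (L : 'I_n -> 'I_n -> 'I_n) :
  n = 2 %[mod 4] -> latin L -> (4 %| signed_count L)%Z.
Proof.
case: n L => // n L n2 [rowL colL]; rewrite signed_count_det.
pose c S := \det (unit_row (symbol_mx L S)).
have detE S : \det (symbol_mx L S) = #|S|%:R * c S.
  apply: det_const_col_sum => j.
  by under eq_bigr => i _ do rewrite mxE; apply: sum_mem_inj (colL j).
have cC S : c (~: S) = - c S.
  have -> : c (~: S) = \det (unit_row (const_mx 1 - symbol_mx L S)).
    congr (\det (unit_row _)); apply/matrixP=> i j; rewrite !mxE inE.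
    by case: (_ \in S).
  rewrite det_unit_row_compl -signr_odd.
  have -> : odd n by lia.
  by rewrite expr1 mulN1r.
have c_even (S : {set 'I_n.+1}) : ~~ odd #|S| -> (2 %| c S)%Z.
  move=> evS; apply: (dvdz_det_row_sum ord0) => i.
  have [->|i0] := eqVneq i ord0.
    under eq_bigr => j _ do rewrite mxE eqxx.
    rewrite sumr_const card_ord; lia.
  under eq_bigr => j _ do rewrite mxE (negbTE i0) mxE.
  by rewrite sum_mem_inj //; lia.
have cardC (S : {set 'I_n.+1}) : (#|S| + #|~: S| = n.+1)%N by rewrite cardsC card_ord.
(* One S from each complementary pair: the one that contains symbol 0. *)
rewrite (bigID (fun S : {set 'I_n.+1} => ord0 \in S)) /=.
rewrite [X in _ + X](reindex_inj (@setC_inj _)) /=.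
rewrite [X in _ + X](eq_bigl (fun S : {set 'I_n.+1} => ord0 \in S)); last first.
  by move=> S; rewrite inE negbK.
rewrite -big_split /=; apply: rpred_sum => S _.
rewrite !detE cC setCK.
have -> : (-1) ^+ #|S| = (-1) ^+ #|~: S| :> int.
  rewrite -[LHS]signr_odd -[RHS]signr_odd; congr (_ ^+ _).
  by have := cardC S; lia.
rewrite -mulrDr dvdz_mull // mulrN -mulNr -mulrDl.
have [oS|evS] := boolP (odd #|S|).
  by rewrite dvdz_mulr //; have := cardC S; lia.
have /dvdzP[q ->] := c_even S evS.
by rewrite mulrCA dvdz_mull //; have := cardC S; lia.
Qed.

(** * Conjugates *)

(** This is the conjugate that exchanges the roles of columns and symbols; with
    transposition it generates all six conjugates. *)
Definition row_conjugate n (L : 'I_n -> 'I_n -> 'I_n)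
  (rowL : forall i, injective (L i)) (i s : 'I_n) : 'I_n := invF (rowL i) s.

Lemma row_conjugateE n (L : 'I_n -> 'I_n -> 'I_n) rowL i j s :
  (@row_conjugate n L rowL i s == j) = (L i j == s).
Proof. by apply/eqP/eqP=> <-; rewrite ?f_invF ?/row_conjugate ?invF_f. Qed.

Lemma latin_row_conjugate n (L : 'I_n -> 'I_n -> 'I_n) rowL :
  latin L -> latin (@row_conjugate n L rowL).
Proof.
case=> _ colL; split=> [i s t /eqP|s i k /eqP].
  by rewrite row_conjugateE f_invF => /eqP.
rewrite row_conjugateE => /eqP; rewrite -{2}(f_invF (rowL k) s).
exact: colL.
Qed.

Lemma latin_tr n (L : 'I_n -> 'I_n -> 'I_n) : latin L -> latin (fun j i => L i j).
Proof. by case. Qed.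

(** * The number of transversals modulo 4 *)

(** [(1 + e1) * (1 + e2)] is 0 or 4 for signs [e1], [e2]; the three terms other
    than 1 in its expansion add up to signed counts of conjugate squares. *)
Lemma dvdn4_card_transversal_pair n (L : 'I_n -> 'I_n -> 'I_n) :
  n = 2 %[mod 4] -> latin L -> (4 %| #|transversal_pair L|)%N.
Proof.
move=> n2 latL; have [rowL colL] := latL.
have D1 := dvdz4_signed_count n2 latL.
have := dvdz4_signed_count n2 (latin_row_conjugate rowL latL).
have -> : signed_count (row_conjugate rowL)
        = \sum_(p | transversal_pair L p) (-1) ^+ p.2.
  (* Exchanging columns and symbols exchanges the two permutations. *)
  rewrite /signed_count (reindex_inj (h := fun p => (p.2, p.1))) /=.
    apply: eq_bigl => p; apply: eq_forallb => i /=.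
    by rewrite row_conjugateE.
  by move=> [s t] [u v] [-> ->].
move=> D2.
have := dvdz4_signed_count n2
  (latin_row_conjugate (L := fun j i => L i j) colL (latin_tr latL)).
have -> : signed_count (row_conjugate (L := fun j i => L i j) colL)
        = \sum_(p | transversal_pair L p) (-1) ^+ p.1 * (-1) ^+ p.2.
  (* Here rows are the columns of L and columns its symbols, so the
     row-to-column permutation is s^-1 * t and the row-to-symbol one is s^-1. *)
  rewrite /signed_count
    (reindex_inj (h := fun p => ((p.1^-1 * p.2)%g, (p.1^-1)%g))) /=.
    apply: eq_big => [p|p _]; last by rewrite odd_permM odd_permV signr_addb.
    apply/forallP/forallP=> /= h i.
      by have := h (p.1 i); rewrite row_conjugateE permM permK.
    by have := h (p.1^-1 i)%g; rewrite row_conjugateE permM permKV.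
  by move=> [s t] [u v] /= [/[swap] /invg_inj -> /mulgI ->].
move=> D3; rewrite -sum1_card.
have : (4 %| \sum_(p | transversal_pair L p)
         (1 + (-1) ^+ p.1) * (1 + (-1) ^+ p.2 : int)%R)%Z.
  by apply: rpred_sum => p _; case: (p.1 : bool); case: (p.2 : bool).
have -> : \sum_(p | transversal_pair L p) (1 + (-1) ^+ p.1) * (1 + (-1) ^+ p.2)
   = (\sum_(p | transversal_pair L p) 1)%N%:R
     + signed_count L + \sum_(p | transversal_pair L p) (-1) ^+ p.2
     + \sum_(p | transversal_pair L p) (-1) ^+ p.1 * (-1) ^+ p.2 :> int.
  rewrite natr_sum -!big_split /=; apply: eq_bigr => p _.
  by move: (_ ^+ p.1) (_ ^+ p.2) => a b; ring.
rewrite -!addrA rpredDr; last by rewrite !rpredD.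
by rewrite natz dvdzE.
Qed.

(** * Transversals as sets of cells *)

Lemma diagonal_graph n (D : {set 'I_n * 'I_n}) :
  diagonal D -> exists s : 'S_n, D = [set (i, s i) | i : 'I_n].
Proof.
case/and3P=> _ /forallP rowD /forallP colD.
have /fin_all_exists[f fP] i : exists j, forall k, ((i, k) \in D) = (k == j).
  have /cards1P[[i' j] Dj] := rowD i; exists j => k.
  have /setP := Dj => /(_ (i, k)); rewrite !inE /= eqxx andbT => ->.
  have /setP/(_ (i', j)) := Dj; rewrite !inE eqxx /= => /andP[_ /eqP->].
  by rewrite xpair_eqE eqxx.
have injf : injective f.
  move=> i k fik; have /cards1P[c Dc] := colD (f i).
  have /setP h := Dc; have := h (i, f i); have := h (k, f i).
  by rewrite !inE /= !fP fik !eqxx => /esym/eqP <- /esym/eqP[->].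
exists (perm injf); apply/setP=> -[i j]; rewrite fP.
apply/eqP/imsetP=> [->|[k _ [-> ->]]]; last by rewrite permE.
by exists i; rewrite ?inE ?permE.
Qed.

Lemma graph_diagonal n (s : 'S_n) : diagonal [set (i, s i) | i : 'I_n].
Proof.
apply/and3P; split.
- by rewrite card_imset ?card_ord // => i j [].
- apply/forallP=> i; apply/cards1P; exists (i, s i); apply/setP=> -[k j].
  rewrite !inE /=; apply/andP/eqP=> [[/imsetP[l _ [-> ->]] /eqP-> //]|[-> ->]].
  by rewrite eqxx imset_f.
apply/forallP=> j; apply/cards1P; exists (s^-1 j, j)%g; apply/setP=> -[i k].
rewrite !inE /=; apply/andP/eqP=> [[/imsetP[l _ [-> ->]] /eqP<-]|[-> ->]].
  by rewrite permK.
by rewrite eqxx -{2}(permKV s j) imset_f.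
Qed.

Lemma num_transversals_pair n (L : 'M['I_n]_n) :
  num_transversals L = #|transversal_pair (fun i j => L i j)|.
Proof.
pose graph (p : 'S_n * 'S_n) := [set (i, p.1 i) | i : 'I_n].
have symE (s : 'S_n) :
    [set L c.1 c.2 | c in [set (i, s i) | i : 'I_n]] = [set L i (s i) | i : 'I_n].
  by rewrite -imset_comp.
rewrite -(card_in_imset (f := graph)) => [|[s t] [u v] /forallP /= hs /forallP /= hu].
  apply: eq_card => D; rewrite inE; apply/andP/imsetP.
    case=> /diagonal_graph[s ->]; rewrite symE => /eqP cardD.
    have /imset_injP injL : #|[set L i (s i) | i : 'I_n]| == #|'I_n|.
      by rewrite cardD card_ord.
    have inj : injective (fun i => L i (s i)) by move=> i j; apply: injL.
    by exists (s, perm inj) => //; apply/forallP=> i /=; rewrite permE.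
  case=> -[s t] /forallP /= st ->; split; first exact: graph_diagonal.
  rewrite symE card_imset ?card_ord // => i j.
  rewrite (eqP (st i)) (eqP (st j)); exact: perm_inj.
move=> /setP eq_graph.
have su : s = u.
  apply/permP=> i; have := eq_graph (i, s i); rewrite imset_f //=.
  by move=> /esym/imsetP[k _ [-> ->]].
congr (_, _) => //; apply/permP=> i.
by rewrite -(eqP (hs i)) -(eqP (hu i)) su.
Qed.

Lemma latin_square_latin n (L : 'M['I_n]_n) :
  latin_square L -> latin (fun i j => L i j).
Proof.
case/andP=> /forallP rowL /forallP colL; split.
  move=> i j k Lijk; have /forallP/(_ (L i j))/cards1P[x /setP h] := rowL i.
  have := h j; have := h k; rewrite !inE Lijk eqxx.
  by move=> /esym/eqP-> /esym/eqP->.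
move=> j i k Lijk; have /forallP/(_ (L i j))/cards1P[x /setP h] := colL j.
have := h i; have := h k; rewrite !inE Lijk eqxx.
by move=> /esym/eqP-> /esym/eqP->.
Qed.

Local Close Scope ring_scope.

Theorem theorem13 (n : nat) (L : 'M['I_n]_n) (hn : n = 2 %[mod 4])
  (hL : latin_square L) : num_transversals L = 0 %[mod 4].
Proof.
have /eqP := dvdn4_card_transversal_pair hn (latin_square_latin hL).
by rewrite num_transversals_pair mod0n.
Qed.
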